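(* Let $A\in\mathbb{R}^{n\times n}$ and $b\in\mathbb{R}^n$, and write $A_s=\frac12(A+A^T)$, $A_a=\frac12(A-A^T)$. If both $A$ and its symmetric part $A_s$ are nonsingular, then $x$ is a solution of the equation $Ax=b$ if and only if it is a solution of the linear symmetric equation $$\bar A x:=A_s^{-1}A^{T}A_s^{-1}Ax=[I-(A_s^{-1}A_a)^2]x=(I-A_s^{-1}A_a)A_s^{-1}b=A_s^{-1}A^{T}A_s^{-1}b .$$
   Context: $A_s$ and $A_a$ are the symmetric and anti-symmetric parts of $A$, so $A=A_s+A_a$; $I$ is the $n\times n$ identity matrix. In the displayed chain, the first two expressions are two forms of the left-hand side $\bar A x$ of the equation, and the last two expressions are two forms of its right-hand side.
   Formalization: The word ''symmetric'' is taken with respect to the bilinear form u^T A_s v (equivalently, A_s Ā = A^T A_s^{-1} A is a symmetric matrix), because Ā itself need not equal its transpose when n ≥ 3. *)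

(* Defs.v *)
From mathcomp Require Import all_boot all_order all_algebra.
From mathcomp Require Import reals.

Set Implicit Arguments.
Unset Strict Implicit.
Unset Printing Implicit Defensive.

Import Order.TTheory GRing.Theory Num.Theory.
Local Open Scope ring_scope.

Definition sym_part (R : realType) (n : nat) (A : 'M[R]_n) : 'M[R]_n :=
  2^-1 *: (A + A^T).

Definition asym_part (R : realType) (n : nat) (A : 'M[R]_n) : 'M[R]_n :=
  2^-1 *: (A - A^T).

Definition Abar (R : realType) (n : nat) (A : 'M[R]_n) : 'M[R]_n :=
  invmx (sym_part A) *m A^T *m invmx (sym_part A) *m A.

Definition form (R : realType) (n : nat) (G : 'M[R]_n) (u v : 'cV[R]_n) : R :=
  (u^T *m G *m v) 0 0.

(* With G = sym_part A this is the sense in which Abar A is symmetric: for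
   n >= 3 the matrix Abar A need not equal its own transpose. The form is
   symmetric and, when G is nonsingular, nondegenerate, but not necessarily
   positive. *)
Definition symmetric_wrt (R : realType) (n : nat) (G M : 'M[R]_n) : Prop :=
  forall u v : 'cV[R]_n, form G (M *m u) v = form G u (M *m v).

(* Main.v *)
Require Import Defs.
From mathcomp Require Import all_boot all_order all_algebra.
From mathcomp Require Import reals.

Set Implicit Arguments.
Unset Strict Implicit.
Unset Printing Implicit Defensive.

Import Order.TTheory GRing.Theory Num.Theory.
Local Open Scope ring_scope.

(* Writing S and K for the symmetric and antisymmetric parts of A, the relations
   A = S + K and A^T = S - K give 1 + S^-1 K = S^-1 A and 1 - S^-1 K = S^-1 A^T,
   whose product is 1 - (S^-1 K)^2.  The operator is symmetric for the form S
   because S (S^-1 A^T S^-1 A) = A^T S^-1 A is a symmetric matrix.  The equation is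
   A x = b multiplied on the left by the invertible matrix S^-1 A^T S^-1. *)

Lemma tr_sym_part (R : realType) (n : nat) (A : 'M[R]_n) :
  (sym_part A)^T = sym_part A.
Proof. by rewrite /sym_part linearZ /= linearD /= trmxK addrC. Qed.

Lemma sym_partD_asym_part (R : realType) (n : nat) (A : 'M[R]_n) :
  sym_part A + asym_part A = A.
Proof.
rewrite /sym_part /asym_part -scalerDr addrACA subrr addr0 -mulr2n.
by rewrite -scaler_nat scalerA mulVf ?pnatr_eq0 // scale1r.
Qed.

Lemma sym_partB_asym_part (R : realType) (n : nat) (A : 'M[R]_n) :
  sym_part A - asym_part A = A^T.
Proof.
rewrite /sym_part /asym_part -scalerBr opprB addrACA [A + _]addrC addrAC.
by rewrite addrA subrK -mulr2n -scaler_nat scalerA mulVf ?pnatr_eq0 // scale1r.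
Qed.

(** The two forms are [u^T M^T G v] and [u^T G M v], so it suffices that [M^T G = G M]; transposing
    [G M] gives this. *)
Lemma symmetric_wrt_mul (R : realType) (n : nat) (G M : 'M[R]_n) :
  G^T = G -> (G *m M)^T = G *m M -> symmetric_wrt G M.
Proof.
move=> symG symGM u v.
have trMG : M^T *m G = G *m M by rewrite -symGM trmx_mul symG.
by rewrite /Defs.form trmx_mul -(mulmxA u^T M^T G) trMG !mulmxA.
Qed.

Lemma sym_part_mul_Abar (R : realType) (n : nat) (A : 'M[R]_n) :
  sym_part A \in unitmx ->
  sym_part A *m Abar A = A^T *m invmx (sym_part A) *m A.
Proof. by move=> hAs; rewrite /Abar !mulmxA mulmxV // mul1mx. Qed.

Lemma sub1_invmx_asym_part (R : realType) (n : nat) (A : 'M[R]_n) :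
  sym_part A \in unitmx ->
  1%:M - invmx (sym_part A) *m asym_part A = invmx (sym_part A) *m A^T.
Proof.
(* Writing the identity as S^-1 S lets S^-1 factor out on the left. *)
by move=> hAs; rewrite -{1}(mulVmx hAs) -mulmxBr sym_partB_asym_part.
Qed.

Lemma add1_invmx_asym_part (R : realType) (n : nat) (A : 'M[R]_n) :
  sym_part A \in unitmx ->
  1%:M + invmx (sym_part A) *m asym_part A = invmx (sym_part A) *m A.
Proof.
by move=> hAs; rewrite -{1}(mulVmx hAs) -mulmxDr sym_partD_asym_part.
Qed.

Lemma AbarE (R : realType) (n : nat) (A : 'M[R]_n) :
  sym_part A \in unitmx ->
  Abar A = 1%:M - (invmx (sym_part A) *m asym_part A) ^+ 2.
Proof.
(* Regrouped as (S^-1 A^T)(S^-1 A), the product becomes (1 - T)(1 + T) with T = S^-1 K; on expansion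
   the terms linear in T cancel. *)
move=> hAs; rewrite /Abar -mulmxA -sub1_invmx_asym_part // -add1_invmx_asym_part //.
rewrite mulmxDr mulmx1 mulmxBl mul1mx expr2 -mulmxE.
by rewrite addrA subrK.
Qed.

Theorem mainTheorem3 (R : realType) (n : nat) (A : 'M[R]_n) (b : 'cV[R]_n)
    (hA : A \in unitmx) (hAs : sym_part A \in unitmx) :
  let As := sym_part A in
  let Aa := asym_part A in
  [/\ symmetric_wrt As (Abar A),
      forall x : 'cV[R]_n,
        Abar A *m x = (1%:M - (invmx As *m Aa) ^+ 2) *m x,
      (1%:M - invmx As *m Aa) *m invmx As *m b
        = invmx As *m A^T *m invmx As *m b
    & forall x : 'cV[R]_n,
        A *m x = b <->
        Abar A *m x = invmx As *m A^T *m invmx As *m b].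
Proof.
move=> As Aa; split.
- apply: symmetric_wrt_mul; first exact: tr_sym_part.
  (* A^T S^-1 A is a congruence of S^-1, which inherits symmetry from S. *)
  by rewrite sym_part_mul_Abar // !trmx_mul trmxK trmx_inv tr_sym_part mulmxA.
- by move=> x; rewrite AbarE.
- by rewrite sub1_invmx_asym_part.
(* Both sides have the left factor P = S^-1 A^T S^-1, applied to [A *m x] and to [b]. The converse
   cancels P, whose middle factor is invertible by [hA]. *)
- move=> x; rewrite /Abar -/As -[_ *m A *m x]mulmxA; split=> [-> //|].
  have unitP : invmx As *m A^T *m invmx As \in unitmx.
    by rewrite !unitmx_mul unitmx_tr unitmx_inv hA hAs.
  by move/(congr1 (mulmx (invmx (invmx As *m A^T *m invmx As)))); rewrite !mulKmx.
Qed.
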